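(* Let $(X,\langle\cdot,\cdot\rangle,\|\cdot\|)$ be a Euclidean vector space. Then $$d_3(x_1,x_2,x_3)=\|x_1-x_2\|\,\|x_1-x_3\|\,\|x_2-x_3\|,\qquad x_1,x_2,x_3\in X,$$ defines a $3$-metric on $X$.
   Context: A Euclidean vector space is a real vector space with an inner product $\langle\cdot,\cdot\rangle$ and induced norm $\|x\|=\langle x,x\rangle^{1/2}$. Let $X$ be a set and $n\ge 2$. A map $d:X^n\to\mathbb{R}$ is a pseudo $n$-metric on $X$ if: (M1, semidefiniteness) if $x_i=x_j$ for some $i\ne j$, then $d(x_1,\ldots,x_n)=0$; (M2, symmetry) $d(x_{\pi(1)},\ldots,x_{\pi(n)})=d(x_1,\ldots,x_n)$ for all $x\in X^n$ and all permutations $\pi$ of $\{1,\ldots,n\}$; (M3, simplex inequality) $d(x_1,\ldots,x_n)\le\sum_{i=1}^n d(x_1,\ldots,x_{i-1},y,x_{i+1},\ldots,x_n)$ for all $x_1,\ldots,x_n,y\in X$. A pseudo $n$-metric is an $n$-metric if it is definite, i.e. $d(x_1,\ldots,x_n)=0$ implies $x_i=x_j$ for some $i\ne j$. A $3$-metric is an $n$-metric with $n=3$. *)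

(* Defs.v *)
From mathcomp Require Import all_boot all_order all_algebra all_fingroup.
From mathcomp Require Import reals.

Set Implicit Arguments.
Unset Strict Implicit.
Unset Printing Implicit Defensive.

Import Order.TTheory GRing.Theory Num.Theory.

Local Open Scope ring_scope.

(* A Euclidean vector space, possibly of infinite dimension, is
   X : lmodType R with R : realType, together with a form
   ip : {dot X for idfun}: bilinear, symmetric and positive definite. *)
Definition ip_norm (R : realType) (X : lmodType R) (ip : {dot X for idfun})
    (x : X) : R :=
  Num.sqrt (ip x x).

Section NMetric.
Variables (R : realType) (X : Type) (n : nat).
Implicit Types (x : {ffun 'I_n -> X}) (d : {ffun 'I_n -> X} -> R).

Definition subst_coord x (i : 'I_n) (y : X) : {ffun 'I_n -> X} :=
  [ffun j => if j == i then y else x j].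

Definition semidefinite d : Prop :=
  forall x (i j : 'I_n), i != j -> x i = x j -> d x = 0.

Definition symmetric_map d : Prop :=
  forall x (s : 'S_n), d [ffun i => x (s i)] = d x.

Definition simplex_inequality d : Prop :=
  forall x (y : X), d x <= \sum_(i < n) d (subst_coord x i y).

Definition definite d : Prop :=
  forall x, d x = 0 -> exists i j : 'I_n, i != j /\ x i = x j.

Definition pseudo_n_metric d : Prop :=
  [/\ (2 <= n)%N, semidefinite d, symmetric_map d & simplex_inequality d].

Definition n_metric d : Prop := pseudo_n_metric d /\ definite d.

End NMetric.

Definition three_metric (R : realType) (X : Type)
    (d : {ffun 'I_3 -> X} -> R) : Prop := n_metric d.

Definition d3 (R : realType) (X : lmodType R) (ip : {dot X for idfun})
    (x1 x2 x3 : X) : R :=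
  ip_norm ip (x1 - x2) * ip_norm ip (x1 - x3) * ip_norm ip (x2 - x3).

(* Main.v *)
(** Translate the new point to the origin and write A, B, C for the norms of a,
    b, c and p, q, r for those of b - c, a - c, a - b.  For
    v = pBC a + qAC b + rAB c, eliminating the inner products gives
      |v|^2 = ABC (pA + qB + rC) (pBC + qAC + rAB - pqr),
    so the last factor is nonnegative.  After the inversion a |-> a / |a|^2 this
    is the classical identity for the distances of a point to the incenter and
    the vertices of a triangle. *)
Require Import Defs.
From mathcomp Require Import all_boot all_order all_algebra all_fingroup.
From mathcomp Require Import reals ring lra.

Import Order.TTheory GRing.Theory Num.Theory.

Local Open Scope ring_scope.

Section EuclideanNorm.
Context {R : realType} {X : lmodType R} (ip : {dot X for idfun}).
Implicit Types a b c x y : X.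

Local Notation N := (ip_norm ip).

Lemma ipC x y : ip x y = ip y x.
Proof. by rewrite hermC expr0 mul1r. Qed.

Lemma ip_gt0 x : x != 0 -> 0 < ip x x.
Proof. exact: neq0_dnorm_gt0. Qed.

Lemma ip_ge0 x : 0 <= ip x x.
Proof.
by have [->|/ip_gt0/ltW//] := eqVneq x 0; rewrite linear0l.
Qed.

Lemma ip_norm_ge0 x : 0 <= N x.
Proof. exact: sqrtr_ge0. Qed.

Lemma ip_norm_sqr x : N x ^+ 2 = ip x x.
Proof. exact/sqr_sqrtr/ip_ge0. Qed.

Lemma ip_norm0 : N 0 = 0.
Proof. by rewrite /ip_norm linear0l sqrtr0. Qed.

Lemma ip_norm_eq0 x : (N x == 0) = (x == 0).
Proof.
apply/idP/eqP => [|->]; last by rewrite ip_norm0.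
by apply: contraTeq => /ip_gt0; rewrite -sqrtr_gt0 => /lt0r_neq0.
Qed.

Lemma ip_normN x : N (- x) = N x.
Proof. by rewrite /ip_norm linearNl linearNr opprK. Qed.

Lemma ip_normB x y : N (x - y) = N (y - x).
Proof. by rewrite -ip_normN opprB. Qed.

(** Law of cosines: it trades every inner product for distances, so that the key inequality becomes
    a statement about six real numbers. *)
Lemma ip_polar x y : ip x y = (N x ^+ 2 + N y ^+ 2 - N (x - y) ^+ 2) / 2.
Proof.
by rewrite !ip_norm_sqr linearBl !linearBr /= (ipC y x); field.
Qed.

Lemma simplex_origin a b c :
  N (a - b) * N (a - c) * N (b - c) <=
  N b * N c * N (b - c) + N a * N c * N (a - c) + N a * N b * N (a - b).
Proof.
(* If one of the points is the origin, both sides agree; removing these cases makes A, B and C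
   positive. *)
have [->|a0] := eqVneq a 0.
  by rewrite !sub0r !ip_normN ip_norm0; lra.
have [->|b0] := eqVneq b 0.
  by rewrite !sub0r !subr0 !ip_normN ip_norm0; lra.
have [->|c0] := eqVneq c 0.
  by rewrite !subr0 ip_norm0; lra.
have N_gt0 x : x != 0 -> 0 < N x.
  by move=> x0; rewrite lt0r ip_norm_eq0 x0 ip_norm_ge0.
(* For b = c the left side vanishes. Otherwise p > 0, which makes pA + qB + rC positive even when q
   or r is zero. *)
have [->|bc] := eqVneq b c.
  rewrite subrr ip_norm0 !mulr0 add0r.
  by rewrite addr_ge0 // !mulr_ge0 // ip_norm_ge0.
have Bbc : 0 < N (b - c) by apply: N_gt0; rewrite subr_eq0.
have := ip_ge0 ((N (b - c) * N b * N c) *: a + (N (a - c) * N a * N c) *: b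
  + (N (a - b) * N a * N b) *: c).
rewrite !linearDl !linearDr /= !linearZl_LR !linearZr_LR /=.
rewrite (ipC b a) (ipC c a) (ipC c b) -!ip_norm_sqr.
rewrite (ip_polar a b) (ip_polar a c) (ip_polar b c).
have := N_gt0 _ a0; have := N_gt0 _ b0; have := N_gt0 _ c0.
(* The norms become free reals; all that is kept of the geometry is their signs and |v|^2 >= 0. *)
move: Bbc (ip_norm_ge0 (a - c)) (ip_norm_ge0 (a - b)).
move: (N a) (N b) (N c) (N (b - c)) (N (a - c)) (N (a - b)).
move=> A B C p q r p_gt0 q_ge0 r_ge0 C_gt0 B_gt0 A_gt0.
have K_gt0 : 0 < A * B * C * (p * A + q * B + r * C).
  rewrite !mulr_gt0 // -addrA ltr_pwDl ?mulr_gt0 //.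
  by rewrite addr_ge0 // mulr_ge0 // ltW.
move=> v2_ge0; rewrite -subr_ge0 -(pmulr_rge0 _ K_gt0).
by apply: etrans v2_ge0; congr (0 <= _); field.
Qed.

(** Together with the swap in [d3C23], this transposition generates all permutations of three
    points. *)
Lemma d3C12 a b c : d3 ip b a c = d3 ip a b c.
Proof. by rewrite /d3 (ip_normB b a); ring. Qed.

Lemma d3C23 a b c : d3 ip a c b = d3 ip a b c.
Proof. by rewrite /d3 (ip_normB c b); ring. Qed.

Lemma d3_simplex a b c y :
  d3 ip a b c <= d3 ip y b c + d3 ip a y c + d3 ip a b y.
Proof.
have := simplex_origin (a - y) (b - y) (c - y).
rewrite !opprB !subrKA /d3 (ip_normB y b) (ip_normB y c); lra.
Qed.

Lemma d3_eq0 a b c : d3 ip a b c = 0 -> [\/ a = b, a = c | b = c].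
Proof.
move/eqP; rewrite !mulf_eq0 !ip_norm_eq0 !subr_eq0.
by move=> /orP[/orP[]|] /eqP; [constructor 1|constructor 2|constructor 3].
Qed.

End EuclideanNorm.

Lemma ord3P (i : 'I_3) : [\/ i = 0, i = 1 | i = 2].
Proof.
case: i => [[|[|[|//]]] lti]; [constructor 1|constructor 2|constructor 3];
  exact: val_inj.
Qed.

Theorem corollary4 (R : realType) (X : lmodType R) (ip : {dot X for idfun}) :
  three_metric (fun x : {ffun 'I_3 -> X} => d3 ip (x 0) (x 1) (x 2)).
Proof.
split; first split=> //.
- by move=> x i j; case: (ord3P i) => ->; case: (ord3P j) => -> // _ xij;
    rewrite /d3 xij subrr ip_norm0 ?mulr0 ?mul0r.
- move=> x s; rewrite !ffunE.
  (* Injectivity of [s] leaves six of the 27 value triples; the identity is trivial and the other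
     five are words in the two swaps. *)
  have /negP : s 0 != s 1 by rewrite (inj_eq perm_inj).
  have /negP : s 0 != s 2 by rewrite (inj_eq perm_inj).
  have /negP : s 1 != s 2 by rewrite (inj_eq perm_inj).
  case: (ord3P (s 0)) => ->; case: (ord3P (s 1)) => ->;
    case: (ord3P (s 2)) => -> // _ _ _.
  + by rewrite d3C23.
  + by rewrite d3C12.
  + by rewrite d3C23 d3C12.
  + by rewrite d3C12 d3C23.
  + by rewrite d3C12 d3C23 d3C12.
- move=> x y; rewrite !big_ord_recl big_ord0 addr0 addrA !ffunE /=.
  exact: d3_simplex.
- move=> x /d3_eq0[] xij; [exists 0, 1|exists 0, 2|exists 1, 2]; by split.
Qed.
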